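(* Let $(\Omega,\mathcal{F},P)$ be a probability space and $T:\Omega\to\Omega$ an invertible measurable transformation. Suppose that for every $A\in\mathcal{F}$ the limit $Q(A):=\lim_{n\to\infty}\frac{1}{n}\sum_{i=0}^{n-1}P(T^iA)$ exists. Then $Q$ is a $T$-invariant probability. Moreover, if $Q$ is ergodic, then $$\lim_{\substack{n+m\to\infty\\ m,n\ge0}}\frac{1}{m+n+1}\sum_{i=-m}^nP(B\cap T^iC)=P(B)Q(C)\quad\text{for all }B,C\in\mathcal{F}\qquad(\ast)$$ and for every $f\in L^1(\Omega,\mathcal{F},Q)$, $$\lim_{\substack{n+m\to\infty\\ m,n\ge0}}\frac{1}{m+n+1}\sum_{i=-m}^nf(T^i\omega)=\int f\,dQ\quad\text{for }P\text{-a.s. }\omega\in\Omega.\qquad(\ast\ast)$$ Conversely, if $(\ast)$ holds or $(\ast\ast)$ holds, then $Q$ is ergodic. In particular, $(\ast)$ and $(\ast\ast)$ are equivalent.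
   Context: $P$ need not be $T$-invariant. $\mathcal{I}=\{A\in\mathcal{F}:T^{-1}A=A\}$; a $T$-invariant probability $Q$ is ergodic if $Q(A)\in\{0,1\}$ for all $A\in\mathcal{I}$. *)

(* Defs.v *)
From HB Require Import structures.
From mathcomp Require Import all_boot all_order all_algebra.
From mathcomp Require Import all_classical all_reals all_analysis.
Set Implicit Arguments. Unset Strict Implicit. Unset Printing Implicit Defensive.
Import Order.TTheory GRing.Theory Num.Theory.
Local Open Scope classical_set_scope.
Local Open Scope ring_scope.

Section Defs.
Context {T : Type} {R : realType}.

Definition Tpow (Tm Tinv : T -> T) (i : int) : T -> T :=
  match i with
  | Posz n => iter n Tm
  | Negz n => iter n.+1 Tinv
  end.

Definition avgP (P : set T -> \bar R) (Tm Tinv : T -> T) (A : set T) (n : nat) : R :=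
  n%:R^-1 * \sum_(i < n) fine (P (Tpow Tm Tinv (Posz i) @` A)).

Definition twosided_avg (a : int -> R) (m n : nat) : R :=
  (m + n + 1)%:R^-1 * \sum_(k < m + n + 1) a (Posz k - Posz m).

Definition lim_mn (u : nat -> nat -> R) (L : R) : Prop :=
  forall e : R, 0 < e -> exists N : nat, forall m n : nat,
    (N <= m + n)%N -> `|u m n - L| < e.

End Defs.

(* Main.v *)
(** The set function [Q] is countably additive because a setwise limit of
    finite measures is a measure; a gliding hump argument shows that it is
    continuous along sequences of sets decreasing to the empty set. As [P] and
    [Q] agree on invariant sets, the [Q]-null invariant sets are [P]-null.

    For the pointwise convergence, let [M 0 = 0] and
    [M n.+1 = max 0 (g + M n \o T)], which dominates the Birkhoff sums of [g].
    The set where [M] is unbounded is invariant. If it had full measure, then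
    [M n.+1 - M n \o T], whose integral is nonnegative by invariance, would
    converge to [g] while being dominated by [`|g|], whence [0 <= \int g].
    When [\int g < 0], ergodicity thus makes the Birkhoff sums of [g] bounded
    above off an invariant null set. This is applied to [f - c] for
    [c > \int f] and to [- f - c] for [c > - \int f], under both [T] and its
    inverse. Mean mixing follows by integrating the averages of the indicator
    of [C] over [B]. *)
Require Import Defs.
From HB Require Import structures.
From mathcomp Require Import all_boot all_order all_algebra.
From mathcomp Require Import all_classical all_reals all_analysis.
From mathcomp Require Import measurable_realfun lra ring zify.
Import Order.TTheory GRing.Theory Num.Theory.
Import numFieldNormedType.Exports.
Local Open Scope classical_set_scope.
Local Open Scope ring_scope.

(** * Setwise limits of finite measures *)

Section setwise_limit.
Context {d : measure_display} {T : measurableType d} {R : realType}.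
Context (mu : {measure set T -> \bar R}^nat).
Hypothesis mu_fin : forall n, fin_num_fun (mu n).

Let a n (A : set T) : R := fine (mu n A).
Hypothesis mu_cvg : forall A, measurable A -> cvgn (a ^~ A).

Let aE n A : measurable A -> mu n A = (a n A)%:E.
Proof. by move=> mA; rewrite fineK// mu_fin. Qed.

Let a_ge0 n A : 0 <= a n A. Proof. exact: fine_ge0. Qed.

Let a_mono n A B : measurable A -> measurable B -> A `<=` B -> a n A <= a n B.
Proof.
move=> mA mB AB; rewrite -lee_fin -!aE//.
by apply: le_measure => //; rewrite inE.
Qed.

Let aU n A B : measurable A -> measurable B -> A `&` B = set0 ->
  a n (A `|` B) = a n A + a n B.
Proof.
move=> mA mB AB; apply: EFin_inj; rewrite EFinD -!aE//; last exact: measurableU.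
by rewrite measureU.
Qed.

Let aU2 n A B : measurable A -> measurable B ->
  a n (A `|` B) <= a n A + a n B.
Proof.
move=> mA mB; rewrite -lee_fin EFinD -!aE//; last exact: measurableU.
exact: measureU2.
Qed.

Let aD n A B : measurable A -> measurable B -> B `<=` A ->
  a n (A `\` B) = a n A - a n B.
Proof.
move=> mA mB BA; apply/eqP; rewrite eq_sym subr_eq eq_sym -aU//.
- by rewrite setUC setDUK.
- exact: measurableD.
- by rewrite setIC setDIK.
Qed.

Let L A : R := limn (a ^~ A).

Let L_near A (e : R) : measurable A -> 0 < e ->
  exists N, forall n, (N <= n)%N -> `|L A - a n A| < e.
Proof.
move=> mA e0; have /cvgrPdist_lt/(_ _ e0)[N _ NP] := mu_cvg A mA.
by exists N => n Nn; exact: NP.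
Qed.

Let L_ge0 A : measurable A -> 0 <= L A.
Proof. by move=> mA; apply: (limr_ge (mu_cvg A mA)); exact: nearW. Qed.

Let LU A B : measurable A -> measurable B -> A `&` B = set0 ->
  L (A `|` B) = L A + L B.
Proof.
move=> mA mB AB; rewrite /L -(limD (mu_cvg A mA) (mu_cvg B mB)).
suff -> : a ^~ (A `|` B) = a ^~ A + a ^~ B by [].
by apply/funext => n; rewrite /= aU.
Qed.

Let L_mono A B : measurable A -> measurable B -> A `<=` B -> L A <= L B.
Proof.
move=> mA mB AB; rewrite -(setDUK AB) LU ?setDIK//; last exact: measurableD.
by rewrite lerDl L_ge0//; exact: measurableD.
Qed.

(* Gliding hump: if the limits for the [C k] have infimum [delta > 0], then
   indices [k i] and [n i] can be chosen such that [mu (n i.+1)] is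
   concentrated, up to [delta / 10], on [C (k i) `\` C (k i.+1)] within
   [C (k 0)]; the union of every other such difference then has masses that
   oscillate with [i]. *)
Lemma setwise_limit_continuous_at_set0 (C : (set T)^nat) :
  (forall k, measurable (C k)) -> nonincreasing_seq C ->
  \bigcap_k C k = set0 ->
  forall e : R, 0 < e -> exists k, L (C k) < e.
Proof.
move=> mC niC C0 e e0; apply: contrapT => /forallNP LCe.
have {}niC i j : (i <= j)%N -> C j `<=` C i by move=> /niC/subsetPset.
have hasinf : has_inf (range (L \o C)).
  by split; [exists (L (C 0%N)), 0%N|exists 0 => _ [k _ <-]; exact: L_ge0].
pose delta := inf (range (L \o C)).
have delta_le k : delta <= L (C k) by apply: ge_inf; [case: hasinf|exists k].
have delta0 : 0 < delta.
  apply: (lt_le_trans e0); apply: lb_le_inf; first by case: hasinf.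
  by move=> _ [k _ <-] /=; rewrite leNgt; apply/negP/LCe.
(* The closing estimates put the limit on [E] above [delta - 3 * eps] and below [4 * eps], which is
   impossible as soon as [delta >= 7 * eps]. *)
pose eps := delta / 10; have eps0 : 0 < eps by rewrite divr_gt0.
have deltaE : delta = 10 * eps by rewrite mulrCA divff ?mulr1// pnatr_eq0.
have [_ [k0 _ <-] /= k0P] := inf_adherent eps0 hasinf.
rewrite -/delta in k0P.
have a_small n : exists K, forall k, (K <= k)%N -> a n (C k) < eps.
  have muC0 : (mu n (C 0%N) < +oo)%E by rewrite ltey_eq mu_fin.
  have mC0 : measurable (\bigcap_k C k) by rewrite C0.
  have niC' : nonincreasing_seq C by move=> i j /niC /subsetPset.
  have := @nonincreasing_cvg_mu _ _ _ (mu n) C muC0 mC mC0 niC'.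
  rewrite C0 measure0 => /fine_cvgP[_ /cvgrPdist_lt/(_ _ eps0)[K _ KP]].
  exists K => k /KP /=; rewrite sub0r normrN ger0_norm//; exact: a_ge0.
(* A pair holds an index into [C] and an index into [mu]. The guard gives every pair a successor, as
   [dependent_choice] requires; along the chosen sequence it always holds, by [k0u]. *)
pose good (p q : nat * nat) := (k0 <= p.1)%N ->
  [/\ (p.1 < q.1)%N, (p.2 < q.2)%N, delta - eps < a q.2 (C p.1),
      a q.2 (C q.1) < eps & a q.2 (C k0 `\` C p.1) < 2 * eps].
have good_ex p : {q | good p q}.
  apply: cid; case: (leqP k0 p.1) => [kp|pk]; last first.
    by exists p; rewrite /good leqNgt pk.
  have [N1 N1P] := L_near _ eps (mC p.1) eps0.
  have eps20 : 0 < eps / 2 by rewrite divr_gt0.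
  have [N2 N2P] := L_near _ _ (mC p.1) eps20.
  have [N3 N3P] := L_near _ _ (mC k0) eps20.
  (* [n] comes first, making [mu n] close to the limit on [C p.1] and [C k0]; only then is [K]
     found, by continuity from above of this one measure. *)
  pose n := (N1 + N2 + N3 + p.2.+1)%N.
  have [K KP] := a_small n.
  exists (K + p.1.+1, n)%N => _; split => /=; [lia|rewrite /n; lia| | |].
  - have /N1P : (N1 <= n)%N by rewrite /n; lia.
    by rewrite ltr_norml; have := delta_le p.1; lra.
  - by apply: KP; lia.
  (* The limits on [C k0] and [C p.1] differ by less than [eps], by the choice of [k0]; each
     approximation adds [eps / 2]. *)
  - rewrite aD//; last exact: niC.
    have /N2P : (N2 <= n)%N by rewrite /n; lia.
    have /N3P : (N3 <= n)%N by rewrite /n; lia.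
    by rewrite !ltr_norml; have := delta_le p.1; lra.
have [u [u0 uP]] := dependent_choice good_ex (k0, 0%N).
have k0u i : (k0 <= (u i).1)%N.
  elim: i => [|i ih]; first by rewrite u0.
  by have [h _ _ _ _] := uP i ih; lia.
have u1 i j : (i <= j)%N -> ((u i).1 <= (u j).1)%N.
  move=> /subnK <-; elim: (j - i)%N => // n ih; rewrite addSn.
  by have [h _ _ _ _] := uP (n + i)%N (k0u _); lia.
have u2 i : (i <= (u i).2)%N.
  by elim: i => // i ih; have [_ h _ _ _] := uP i (k0u i); lia.
pose D i := C (u i).1 `\` C (u i.+1).1.
have mD i : measurable (D i) by exact: measurableD.
pose E := \bigcup_i D i.*2.
have mE : measurable E by exact: bigcup_measurable.
have [N NP] := L_near E eps mE eps0.
have E_large : delta - 2 * eps < a (u N.*2.+1).2 E.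
  apply: (@lt_le_trans _ _ (a (u N.*2.+1).2 (D N.*2))); last first.
    by apply: a_mono => // x Dx; exists N.
  rewrite aD//; last exact/niC/u1.
  by have [_ _ h1 h2 _] := uP N.*2 (k0u _); lra.
have E_small : a (u N.*2.+2).2 E < 3 * eps.
  have [_ _ _ h1 h2] := uP N.*2.+1 (k0u _).
  (* The pieces of [E] with [i <= N] lie in the first set of the cover, of mass below [2 * eps]; the
     later ones lie in the second, of mass below [eps]. *)
  apply: (@le_lt_trans _ _ (a (u N.*2.+2).2
    ((C k0 `\` C (u N.*2.+1).1) `|` C (u N.*2.+2).1))).
    apply: a_mono => //; first by apply: measurableU => //; exact: measurableD.
    move=> x [i _ [xi nxi]]; have [iN|Ni] := leqP i N.
      left; split; first by apply: niC xi.
      by apply: contra_not nxi; apply/niC/u1; lia.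
    by right; apply: niC xi; apply: u1; lia.
  have := aU2 (u N.*2.+2).2 _ _ (measurableD (mC k0) (mC (u N.*2.+1).1))
    (mC (u N.*2.+2).1).
  lra.
have /NP : (N <= (u N.*2.+1).2)%N by have := u2 N.*2.+1; lia.
have /NP : (N <= (u N.*2.+2).2)%N by have := u2 N.*2.+2; lia.
rewrite !ltr_norml; lra.
Qed.

(** Finite additivity passes to the limit, and continuity at the empty set, applied to the tails of
    a disjoint union, makes it countable. *)
Theorem setwise_limit_measure : exists nu : {measure set T -> \bar R},
  forall A, measurable A -> nu A = (limn (fun n => fine (mu n A)))%:E.
Proof.
(* The norm only matters on nonmeasurable sets, where the limit may not exist. *)
pose nu (A : set T) : \bar R := (`|L A|)%:E.
have nuE A : measurable A -> nu A = (L A)%:E.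
  by move=> mA; rewrite /nu ger0_norm// L_ge0.
have L0 : L set0 = 0.
  rewrite /L (_ : a ^~ _ = cst 0) ?lim_cst//.
  by apply/funext => n; rewrite /a measure0.
have nu0 : nu set0 = 0%E by rewrite nuE// L0.
have nu_ge0 A : (0 <= nu A)%E by rewrite lee_fin.
have nu_additive : semi_sigma_additive nu.
  move=> F mF tF mUF.
  pose C k := \bigcup_(i in [set i | (k <= i)%N]) F i.
  have mC k : measurable (C k) by exact: bigcup_measurable.
  have niC : nonincreasing_seq C.
    move=> i j ij; apply/subsetPset => x [n /= jn Fx].
    by exists n => //=; exact: leq_trans jn.
  have C0 : \bigcap_k C k = set0.
    apply/seteqP; split => // x Cx.
    have [i _ Fi] := Cx 0%N I; have [j /= ij Fj] := Cx i.+1 I.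
    by have : i = j by [apply: (tF i j I I); exists x]; lia.
  have sumC n : L (\bigcup_i F i) = \sum_(0 <= i < n) L (F i) + L (C n).
    elim: n => [|n ih].
      rewrite big_nil add0r; congr L.
      by apply: eq_bigcupl; split => i.
    rewrite ih big_nat_recr//= -addrA -LU//.
      congr (_ + L _); apply/seteqP; split => [x [i /= ni Fx]|x [Fx|[i /= ni Fx]]].
      - have [->|ni'] := eqVneq n i; first by left.
        by right; exists i => //=; lia.
      - by exists n => /=.
      - by exists i => //=; lia.
    apply/seteqP; split => // x [Fn [i /= ni Fx]].
    by have : n = i by [apply: (tF n i I I); exists x]; lia.
  rewrite nuE//.
  rewrite (_ : (fun n => _) = EFin \o (fun n => \sum_(0 <= i < n) L (F i)));
    last by apply/funext => n; rewrite /= -sumEFin;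
      apply: eq_bigr => i _; rewrite nuE.
  apply: cvg_EFin; first exact: nearW.
  apply/cvgrPdist_lt => e e0.
  have [k kP] := setwise_limit_continuous_at_set0 C mC niC C0 e e0.
  exists k => // n /= kn; rewrite (sumC n) addrAC subrr add0r ger0_norm ?L_ge0//.
  apply: le_lt_trans kP; apply: L_mono => //.
  exact/subsetPset/niC.
pose nu' : {measure set T -> \bar R} :=
  HB.pack nu (isMeasure.Build _ _ _ nu nu0 nu_ge0 nu_additive).
by exists nu'.
Qed.

End setwise_limit.

(** * Integration under a measure-preserving map *)

Section measure_preserving.
Context {d : measure_display} {T : measurableType d} {R : realType}.
Context {Q : {measure set T -> \bar R}} {S : T -> T}.
Hypothesis mS : measurable_fun setT S.
Hypothesis Q_inv : forall A, measurable A -> Q (S @^-1` A) = Q A.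
Local Open Scope ereal_scope.

(** The nonnegative case comes first because, applied to the absolute value, it gives the
    integrability of [h \o S] on which the signed case relies. *)
Lemma measure_preserving_ge0_integral (h : T -> \bar R) :
  measurable_fun setT h -> (forall x, 0 <= h x) ->
  \int[Q]_x h (S x) = \int[Q]_x h x.
Proof.
move=> mh h0; transitivity (\int[pushforward Q S]_x h x).
  by rewrite (ge0_integral_pushforward mS)// preimage_setT.
by apply: eq_measure_integral => A mA _; exact: Q_inv.
Qed.

Lemma measure_preserving_integrable (h : T -> \bar R) :
  Q.-integrable setT h -> Q.-integrable setT (h \o S).
Proof.
move=> /integrableP[mh hoo]; apply/integrableP; split.
  exact: measurableT_comp.
rewrite (measure_preserving_ge0_integral (fun x => `|h x|))//.
exact: measurableT_comp.
Qed.

Lemma measure_preserving_integral (h : T -> \bar R) :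
  Q.-integrable setT h -> \int[Q]_x h (S x) = \int[Q]_x h x.
Proof.
move=> ih; have /integrableP[mh _] := ih.
transitivity (\int[pushforward Q S]_x h x).
  rewrite (integral_pushforward mS)// preimage_setT//.
  exact: measure_preserving_integrable.
by apply: eq_measure_integral => A mA _; exact: Q_inv.
Qed.

End measure_preserving.

(** * Birkhoff sums and their running maxima *)

Definition birkhoff_sum {T : Type} {R : realType} (S : T -> T) (f : T -> R)
  (n : nat) (x : T) : R := \sum_(i < n) f (iter i S x).

Section maximal_ergodic.
Context {d : measure_display} {T : measurableType d} {R : realType}.
Context {Q : probability T R} {S : T -> T} {g : T -> R}.
Hypothesis mS : measurable_fun setT S.
Hypothesis Q_inv : forall A, measurable A -> Q (S @^-1` A) = Q A.
Hypothesis ig : Q.-integrable setT (EFin \o g).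

(* [M n] is the maximum of the Birkhoff sums of length at most [n]. *)
Let M := fix M (n : nat) (x : T) : R :=
  if n is n'.+1 then Num.max 0 (g x + M n' (S x)) else 0.

Let mg : measurable_fun setT g.
Proof. by have /measurable_int/measurable_EFinP := ig. Qed.

Let M_ge0 n x : 0 <= M n x.
Proof. by case: n => [|n] //=; rewrite le_max lexx. Qed.

Let MS n x : g x + M n (S x) <= M n.+1 x.
Proof. by rewrite /= le_max lexx orbT. Qed.

Let M_leS n x : M n x <= M n.+1 x.
Proof.
elim: n x => [|n ih] x; first exact: M_ge0.
by rewrite /= ge_max le_max lexx/= le_max lerD2l ih orbT.
Qed.

Let M_homo x m n : (m <= n)%N -> M m x <= M n x.
Proof.
by move=> mn; apply: (@homo_leq _ (M ^~ x) <=%O) mn => //; exact: le_trans.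
Qed.

Let birkhoff_sum_le n x : birkhoff_sum S g n x <= M n x.
Proof.
elim: n x => [|n ih] x; rewrite /birkhoff_sum; first by rewrite big_ord0.
rewrite big_ord_recl/=; apply: le_trans (MS n x); rewrite lerD2l.
apply: le_trans (ih _); rewrite /birkhoff_sum le_eqVlt; apply/orP; left.
by apply/eqP/eq_bigr => i _; rewrite -iterSr.
Qed.

Let mM n : measurable_fun setT (M n).
Proof.
elim: n => [|n ih]; first exact: measurable_cst.
apply: measurable_maxr; first exact: measurable_cst.
by apply: measurable_funD => //; exact: measurableT_comp.
Qed.

Let iM n : Q.-integrable setT (EFin \o M n).
Proof.
elim: n => [|n ih]; first exact: finite_measure_integrable_cst.
apply: (le_integrable measurableT _ _
  (integrableD measurableT ig (measure_preserving_integrable mS Q_inv _ ih))).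
  exact/measurable_EFinP/mM.
move=> x _; rewrite -EFinD !abse_EFin lee_fin ger0_norm ?M_ge0//=.
by rewrite ge_max normr_ge0 ler_norm.
Qed.

Let E := [set x | forall K : nat, exists n, K%:R < M n x].

Let mE : measurable E.
Proof.
rewrite (_ : E = \bigcap_K \bigcup_n (setT `&` [set x | (K%:R%:E < (M n x)%:E)%E])).
  apply: bigcap_measurable => // K _; apply: bigcup_measurable => n _.
  by apply: measurable_lte => //; exact/measurable_EFinP.
apply/seteqP; split => x /= h K;
  first by have [n] := h K; exists n => //; rewrite setTI.
by have [n _ [_]] := h K I; exists n.
Qed.

Let E_inv : S @^-1` E = E.
Proof.
apply/seteqP; split => x /= Ex K.
  (* Passing from [S x] to [x] changes the maxima by at most [g x], so asking for a level higher by
     an integer above [|g x|] absorbs the loss. *)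
  have [n nP] := Ex (K + Num.trunc (`|g x|)).+1.
  exists n.+1; apply: lt_le_trans (MS n x).
  have := truncnS_gt (`|g x|); have := ler_norm (- g x); rewrite normrN.
  move: nP; rewrite -addnS natrD; lra.
(* The raised level is positive, so the maximum defining [M n.+1 x] is attained by [g x + M n (S x)]
   and not by [0]. *)
have [n nP] := Ex (K + Num.trunc (`|g x|)).+1.
exists n; have := M_leS n x; rewrite /= => h.
have {nP}h := lt_le_trans nP h.
have := truncnS_gt (`|g x|); have := ler_norm (g x).
move: h; rewrite -addnS natrD lt_max => /orP[]; last lra.
have : 0 <= K%:R :> R by []; have : 0 <= (Num.trunc `|g x|).+1%:R :> R by [].
lra.
Qed.

Let integral_ge0_of_unbounded : Q E = 1%E -> (0 <= \int[Q]_x (g x)%:E)%E.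
Proof.
move=> QE1.
(* [h n = M n.+1 - M n \o S] has nonnegative integral and is eventually [g]
   on [E]. *)
pose h n x := Num.max (- M n (S x)) (g x).
have hE n x : h n x = M n.+1 x - M n (S x).
  by rewrite /h /= addr_maxl sub0r addrK.
have ih n : (0 <= \int[Q]_x (h n x)%:E)%E.
  under eq_integral do rewrite hE EFinB.
  have iMS := measure_preserving_integrable mS Q_inv _ (iM n).
  rewrite integralB_EFin//.
  rewrite (measure_preserving_integral mS Q_inv (EFin \o M n))//.
  rewrite sube_ge0; last by rewrite (integrable_fin_num measurableT (iM n)).
  by apply: le_integral => //; [exact: iM..|move=> x _; rewrite lee_fin].
have mh n : measurable_fun setT (EFin \o h n).
  apply/measurable_EFinP/measurable_maxr => //.
  by apply: measurable_funN; exact: measurableT_comp.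
have [] := @dominated_convergence _ _ _ Q setT measurableT (fun n => EFin \o h n)
  (EFin \o g) (EFin \o (Num.norm \o g)) mh.
- exact/measurable_EFinP.
- exists (~` E); split; first exact: measurableC.
    by have := probability_setC Q mE; rewrite QE1 subee.
  move=> x /= hx Ex; apply: hx => _.
  (* By invariance [M n (S x)] is unbounded too; once it exceeds [|g x|], the maximum defining
     [h n x] equals [g x]. *)
  have SEx : E (S x) by rewrite -[E _]/((S @^-1` E) x) E_inv.
  have [N NP] := SEx (Num.trunc (`|g x|)).+1.
  apply: cvg_near_cst; exists N => // n /= Nn; congr EFin; apply/max_idPr.
  have := truncnS_gt (`|g x|); have := ler_norm (- g x); rewrite normrN.
  have := M_homo (S x) _ _ Nn; lra.
- exact: integrable_norm.
(* If [h n x] differs from [g x], then it is [- M n (S x)], which lies between [g x] and [0]. *)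
- apply: aeW => x n _; rewrite /= lee_fin /h.
  have [_|hM] := leP (- M n (S x)) (g x); first exact: lexx.
  rewrite normrN ger0_norm ?M_ge0// -[leRHS]normrN.
  by apply: le_trans (ler_norm _); rewrite lerNr ltW.
move=> _ _ cvgh; rewrite -(cvg_lim _ cvgh)//.
by apply: lime_ge; [apply/cvg_ex; eexists; exact: cvgh|exact: nearW].
Qed.

(** The invariance of the exceptional set is recorded because it is what later makes the set null
    for [P] as well as for [Q]. *)
Lemma birkhoff_sum_bounded_above :
  (forall A, measurable A -> S @^-1` A = A -> Q A = 0%E \/ Q A = 1%E) ->
  (\int[Q]_x (g x)%:E < 0)%E ->
  exists A, [/\ measurable A, S @^-1` A = A, Q A = 0%E &
    forall x, ~ A x -> exists K, forall n, birkhoff_sum S g n x <= K].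
Proof.
move=> erg int0; exists E; split => //.
  have [//|QE1] := erg E mE E_inv.
  by move: int0; rewrite ltNge integral_ge0_of_unbounded.
move=> x /existsNP[K /forallNP KP]; exists K%:R => n.
by apply: le_trans (birkhoff_sum_le n x) _; rewrite leNgt; exact/negP/KP.
Qed.

End maximal_ergodic.

(** * Averages over two-sided windows *)

Lemma cancel_iter {T : Type} (f g : T -> T) (n : nat) :
  cancel f g -> cancel (iter n f) (iter n g).
Proof.
by move=> fK; elim: n => // n ih x; rewrite iterSr [iter n.+1 f x]iterS fK ih.
Qed.

Lemma sum_shifted_ord {R : realType} (a : int -> R) (m n : nat) :
  \sum_(k < m + n + 1) a (Posz k - Posz m) =
  \sum_(i < m) a (Negz i) + \sum_(i < n.+1) a (Posz i).
Proof.
elim: m => [|m ih].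
  rewrite big_ord0 add0r add0n addn1.
  by apply: eq_bigr => i _; rewrite subr0.
rewrite [X in _ = X + _]big_ord_recr/= addrAC -ih addrC !addSn big_ord_recl sub0r.
congr (_ + _).
by apply: eq_bigr => i _; congr a; rewrite /= /bump/=; lia.
Qed.

Section two_sided_averages.
Context {T : Type} {R : realType} {Tm Tinv : T -> T}.

Lemma two_sided_sum_le (f : T -> R) (c : R) (x : T) :
  (exists K, forall n, birkhoff_sum Tm f n x <= n%:R * c + K) ->
  (exists K, forall n, birkhoff_sum Tinv f n x <= n%:R * c + K) ->
  exists K, forall m n,
    \sum_(k < m + n + 1) f (Tpow Tm Tinv (Posz k - Posz m) x) <=
    (m + n + 1)%:R * c + K.
Proof.
(* The one-sided bounds are used at lengths [n.+1] and [m.+1]: both sums contain [f x], so one copy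
   is removed, and the lengths exceed the window by one, whence the extra [c]. *)
move=> [K1 K1P] [K2 K2P]; exists (c + K1 + K2 - f x) => m n.
rewrite (sum_shifted_ord (fun i => f (Tpow Tm Tinv i x))).
have := K1P n.+1; have := K2P m.+1.
rewrite {1}/birkhoff_sum big_ord_recl/= -/(birkhoff_sum Tm f n.+1 x).
rewrite -!natr1 !natrD; lra.
Qed.

(** Dividing by the window length kills [K], which may depend on [j] but not on [m] and [n]. The
    slacks form a countable family so that the bounds can hold simultaneously almost everywhere. *)
Lemma lim_mn_twosided_avg (a : int -> R) (l : R) :
  (forall j, exists K : R, forall m n, \sum_(k < m + n + 1) a (Posz k - Posz m) <=
    (m + n + 1)%:R * (l + j.+1%:R^-1) + K) ->
  (forall j, exists K : R, forall m n, \sum_(k < m + n + 1) - a (Posz k - Posz m) <=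
    (m + n + 1)%:R * (- l + j.+1%:R^-1) + K) ->
  lim_mn (twosided_avg a) l.
Proof.
move=> up lo e e0.
have e20 : 0 < e / 2 by rewrite divr_gt0.
have [j] := ltr_add_invr e20; rewrite add0r => jP.
have [K1 K1P] := up j; have [K2 K2P] := lo j.
pose K := `|K1| + `|K2|.
(* From here on [K] is less than [e / 2] times the window length; the slack uses the other half of
   [e]. *)
exists (Num.trunc (K / (e / 2))).+1 => m n Nmn.
have p0 : 0 < (m + n + 1)%:R :> R by rewrite ltr0n addn1.
have KP : K < (m + n + 1)%:R * (e / 2).
  rewrite -ltr_pdivrMr//; apply: (lt_le_trans (truncnS_gt _)).
  by rewrite ler_nat; exact: leq_trans Nmn (leq_addr _ _).
move: (K1P m n) (K2P m n); rewrite sumrN /twosided_avg.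
set s := \sum_(k < _) _; set p := (m + n + 1)%:R in p0 KP * => sup slo.
have pj : p * j.+1%:R^-1 <= p * (e / 2) by rewrite ler_pM2l// ltW.
have [K1n K2n] := (ler_norm K1, ler_norm K2).
have [K1p K2p] := (normr_ge0 K1, normr_ge0 K2).
rewrite (_ : p^-1 * s - l = p^-1 * (s - p * l)); last by field; rewrite gt_eqF.
rewrite normrM gtr0_norm ?invr_gt0// ltr_pdivrMl// ltr_norml.
move: KP pj sup slo; rewrite /K; move: (j.+1%:R^-1) => q.
by rewrite !mulrDr mulrN => KP pj sup slo; apply/andP; split; lra.
Qed.

End two_sided_averages.

Lemma twosided_avg_opp {R : realType} (a : int -> R) (m n : nat) :
  twosided_avg (fun i => a (- i)) m n = twosided_avg a n m.
Proof.
rewrite /twosided_avg (addnC n m); congr (_ * _).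
rewrite (reindex_inj rev_ord_inj); apply: eq_bigr => k _; congr a => /=.
by have := ltn_ord k; lia.
Qed.

Lemma twosided_avg_cst {R : realType} (c : R) (m n : nat) :
  twosided_avg (fun=> c) m n = c.
Proof.
by rewrite /twosided_avg sumr_const card_ord -(mulr_natl c) mulrA mulVf ?mul1r.
Qed.

Lemma lim_mn_twosided_avg_cst {R : realType} (c l : R) :
  lim_mn (twosided_avg (fun=> c)) l -> c = l.
Proof.
move=> cl; apply/eqP; rewrite -subr_eq0 -normr_le0; apply/ler_addgt0Pl => e e0.
have [N /(_ N 0%N)] := cl e e0; rewrite addn0 addr0 twosided_avg_cst.
by move=> /(_ (leqnn N))/ltW.
Qed.

(** * Integer powers of an invertible map *)

Section invertible_map.
Context {d : measure_display} {T : measurableType d} {Tm Tinv : T -> T}.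
Hypothesis mTm : measurable_fun setT Tm.
Hypothesis mTinv : measurable_fun setT Tinv.
Hypothesis TK : cancel Tm Tinv.
Hypothesis TinvK : cancel Tinv Tm.

Lemma measurable_fun_iter (S : T -> T) (n : nat) :
  measurable_fun setT S -> measurable_fun setT (iter n S).
Proof.
move=> mS; elim: n => [|n ih]; first exact: measurable_id.
exact: (measurableT_comp mS ih).
Qed.

Lemma measurable_Tpow (i : int) : measurable_fun setT (Tpow Tm Tinv i).
Proof. by case: i => n; exact: measurable_fun_iter. Qed.

Lemma image_Tpow (i : int) (A : set T) :
  Tpow Tm Tinv i @` A = Tpow Tm Tinv (- i) @^-1` A.
Proof.
have TpowK j : cancel (Tpow Tm Tinv j) (Tpow Tm Tinv (- j)).
  case: j => [[|n]|n] x //; first exact: (cancel_iter Tm Tinv n.+1).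
  exact: (cancel_iter Tinv Tm n.+1).
apply/seteqP; split=> [_ [x Ax <-]|x Ax]; first by rewrite /= TpowK.
by exists (Tpow Tm Tinv (- i) x) => //; rewrite -[X in Tpow _ _ X](opprK i) TpowK.
Qed.

Lemma measurable_image_Tpow (i : int) (A : set T) :
  measurable A -> measurable (Tpow Tm Tinv i @` A).
Proof.
by move=> mA; rewrite image_Tpow -[X in measurable X]setTI; exact: measurable_Tpow.
Qed.

Lemma invariant_Tpow (i : int) (A : set T) (x : T) :
  Tm @^-1` A = A -> A (Tpow Tm Tinv i x) = A x.
Proof.
move=> AT; have TA y : A (Tm y) = A y by rewrite -[in RHS]AT.
have TinvA y : A (Tinv y) = A y by rewrite -TA TinvK.
by case: i => n /=; [|rewrite TinvA]; elim: n => //= n <-; rewrite ?TA ?TinvA.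
Qed.

End invertible_map.

(** [f - c] has negative integral because [Q] has total mass one, so its Birkhoff sums are bounded
    above off an invariant null set. *)
Lemma birkhoff_sum_le_linear {d : measure_display} {T : measurableType d}
  {R : realType} {Q : probability T R} {S : T -> T} (f : T -> R) (c : R) :
  measurable_fun setT S ->
  (forall A, measurable A -> Q (S @^-1` A) = Q A) ->
  (forall A, measurable A -> S @^-1` A = A -> Q A = 0%E \/ Q A = 1%E) ->
  Q.-integrable setT (EFin \o f) -> (\int[Q]_x (f x)%:E < c%:E)%E ->
  exists A, [/\ measurable A, S @^-1` A = A, Q A = 0%E & forall x, ~ A x ->
    exists K, forall n, birkhoff_sum S f n x <= n%:R * c + K].
Proof.
move=> mS Q_inv erg intf fc.
have intc := finite_measure_integrable_cst Q c measurableT.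
have [|A [mA AS QA AP]] := birkhoff_sum_bounded_above (g := fun x => f x - c)
  mS Q_inv (integrableB measurableT intf intc) erg.
  under eq_integral do rewrite EFinB.
  rewrite (integralB_EFin (f2 := cst c))//.
  suff -> : (\int[Q]_x (cst c x)%:E = c%:E)%E by rewrite lteBlDr// add0e.
  transitivity (c%:E * Q setT)%E; last by rewrite probability_setT mule1.
  exact: (integral_cst Q measurableT c%:E).
exists A; split => // x /AP[K KP]; exists K => n; have := KP n.
by rewrite /birkhoff_sum sumrB sumr_const card_ord mulr_natl lerBlDl.
Qed.

(** * Ergodicity, pointwise convergence and mean mixing *)

Section ergodic_limit.
Context {d : measure_display} {Omega : measurableType d} {R : realType}.
Context {P Q : probability Omega R} {Tm Tinv : Omega -> Omega}.
Hypothesis mTm : measurable_fun setT Tm.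
Hypothesis mTinv : measurable_fun setT Tinv.
Hypothesis TK : cancel Tm Tinv.
Hypothesis TinvK : cancel Tinv Tm.
Hypothesis Q_inv : forall A, measurable A -> Q (Tm @^-1` A) = Q A.
Hypothesis PQ : forall A, measurable A -> Tm @^-1` A = A -> P A = Q A.

Let ergodic := forall A, measurable A -> Tm @^-1` A = A ->
  Q A = 0%E \/ Q A = 1%E.

Let invariant_of_Tinv (A : set Omega) : Tinv @^-1` A = A -> Tm @^-1` A = A.
Proof.
by move=> AT; rewrite -[in LHS]AT; apply/seteqP; split => x /=; rewrite TK.
Qed.

Let Q_inv_Tinv A : measurable A -> Q (Tinv @^-1` A) = Q A.
Proof.
move=> mA; rewrite -Q_inv.
  by congr (Q _); apply/seteqP; split => x /=; rewrite TK.
by rewrite -[X in measurable X]setTI; exact: mTinv.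
Qed.

(** For each [j], the exceptional sets of [Tm] and [Tinv] are [Q]-null and invariant, hence [P]-null
    by [PQ]; off both, the one-sided bounds combine. *)
Let ae_two_sided_sum_le (f : Omega -> R) : ergodic ->
  Q.-integrable setT (EFin \o f) ->
  {ae P, forall w j, exists K, forall m n,
    \sum_(k < m + n + 1) f (Tpow Tm Tinv (Posz k - Posz m) w) <=
    (m + n + 1)%:R * (fine (\int[Q]_x (f x)%:E) + j.+1%:R^-1) + K}.
Proof.
move=> erg intf; apply: ae_foralln => j.
set c := _ + j.+1%:R^-1.
have fc : (\int[Q]_x (f x)%:E < c%:E)%E.
  rewrite /c EFinD fineK ?lteDl// ?lte_fin ?invr_gt0//.
  - exact: integrable_fin_num.
  - exact: integrable_fin_num.
have [A [mA AT QA AP]] := birkhoff_sum_le_linear f c mTm Q_inv erg intf fc.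
have erg' B : measurable B -> Tinv @^-1` B = B -> Q B = 0%E \/ Q B = 1%E.
  by move=> mB /invariant_of_Tinv; exact: erg.
have [B [mB /invariant_of_Tinv BT QB BP]] :=
  birkhoff_sum_le_linear f c mTinv Q_inv_Tinv erg' intf fc.
apply: (@filterS2 _ (almost_everywhere P) _ _ _ _ (fun w => two_sided_sum_le f c w)).
  exists A; split => //; first by rewrite PQ.
  by move=> w /= h; apply: contrapT => /AP.
exists B; split => //; first by rewrite PQ.
by move=> w /= h; apply: contrapT => /BP.
Qed.

Lemma ergodic_two_sided_birkhoff : ergodic ->
  forall f : Omega -> R, Q.-integrable setT (EFin \o f) ->
  {ae P, forall w, lim_mn (twosided_avg (fun i => f (Tpow Tm Tinv i w)))
                          (fine (\int[Q]_x (f x)%:E))}.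
Proof.
move=> erg f intf.
have intNf : Q.-integrable setT (EFin \o (fun x => - f x)).
  exact: integrableN intf.
apply: filterS2 (ae_two_sided_sum_le f erg intf)
  (ae_two_sided_sum_le (fun x => - f x) erg intNf) => w up lo.
apply: lim_mn_twosided_avg => // j; have [K KP] := lo j; exists K => m n.
suff <- : fine (\int[Q]_x (- f x)%:E) = - fine (\int[Q]_x (f x)%:E) by exact: KP.
under eq_integral do rewrite EFinN.
by rewrite integralN ?fineN// integrable_add_def.
Qed.

(** A point lies in the image of [C] under the power [i] exactly when its power [- i] lies in [C];
    this sign change swaps the two ends of the window. *)
Lemma twosided_avg_integral (B C : set Omega) (m n : nat) :
  measurable B -> measurable C ->
  (\int[P]_(w in B) (twosided_avg (fun i => \1_C (Tpow Tm Tinv i w)) n m)%:E)%E =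
  (twosided_avg (fun i => fine (P (B `&` (Tpow Tm Tinv i @` C)))) m n)%:E.
Proof.
move=> mB mC.
under eq_integral do rewrite /twosided_avg EFinM -sumEFin.
have mCi (i : int) : measurable_fun B (fun w => (\1_C (Tpow Tm Tinv i w) : R)%:E).
  apply/measurable_EFinP/measurable_funTS.
  by apply: measurableT_comp; [exact: measurable_indic|exact: measurable_Tpow].
rewrite ge0_integralZl_EFin//; last 2 first.
- by move=> w _; apply: sume_ge0 => k _; rewrite lee_fin.
- by apply: emeasurable_sum => k; exact: mCi.
rewrite ge0_integral_sum//.
rewrite -twosided_avg_opp /twosided_avg EFinM -sumEFin (addnC n m).
congr (_ * _)%E; apply: eq_bigr => k _.
have mT : measurable (Tpow Tm Tinv (Posz k - Posz n) @^-1` C).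
  by rewrite -[X in measurable X]setTI; exact: measurable_Tpow.
rewrite image_Tpow// opprK fineK;
  last by rewrite fin_num_measure//; exact: measurableI.
by rewrite (integral_indic P mB mT) setIC.
Qed.

(** Dominated convergence handles sequences only, so a failure of the double limit is first turned
    into a sequence of bad windows [mn], along which the integrated averages would nevertheless
    converge. *)
Lemma two_sided_mean_mixing (B C : set Omega) : measurable B -> measurable C ->
  {ae P, forall w, lim_mn (twosided_avg (fun i => \1_C (Tpow Tm Tinv i w)))
                          (fine (Q C))} ->
  lim_mn (twosided_avg (fun i => fine (P (B `&` (Tpow Tm Tinv i @` C)))))
         (fine (P B) * fine (Q C)).
Proof.
move=> mB mC aeC; apply: contrapT => /existsNP[e /not_implyP[e0 /forallNP eP]].
have {}eP N : exists mn : nat * nat, (N <= mn.1 + mn.2)%N /\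
    e <= `|twosided_avg (fun i => fine (P (B `&` (Tpow Tm Tinv i @` C)))) mn.1 mn.2 -
          fine (P B) * fine (Q C)|.
  have /existsNP[m /existsNP[n /not_implyP[Nmn /negP]]] := eP N.
  by rewrite -leNgt => ?; exists (m, n).
have [mn mnP] := choice eP.
pose F N w := twosided_avg (fun i => \1_C (Tpow Tm Tinv i w) : R) (mn N).2 (mn N).1.
have mF N : measurable_fun B (EFin \o F N).
  apply/measurable_EFinP/measurable_funTS/measurable_funM => //.
  apply: measurable_sum => k.
  by apply: measurableT_comp; [exact: measurable_indic|exact: measurable_Tpow].
have [] := @dominated_convergence _ _ _ P B mB (fun n => EFin \o F n)
  (cst (fine (Q C))%:E) (cst 1%E) mF.
- exact: measurable_cst.
- apply: filterS aeC => w wP _; apply/cvg_EFin; first exact: nearW.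
  apply/cvgrPdist_lt => r r0; have [N NP] := wP r r0.
  exists N => // k /= Nk; rewrite distrC; apply: NP; rewrite addnC.
  by apply: leq_trans Nk _; have [] := mnP k.
- exact: finite_measure_integrable_cst.
- apply: aeW => w N _; rewrite /= lee_fin /F /twosided_avg.
  rewrite ger0_norm; last by rewrite mulr_ge0 ?invr_ge0// sumr_ge0.
  rewrite ler_pdivrMl ?ltr0n ?addn1// mulr1.
  rewrite -[X in X%:R]card_ord -sumr_const.
  by apply: ler_sum => k _; rewrite indicE; case: (_ \in _).
move=> _ _; rewrite integral_cst// => cvgF.
pose u N := twosided_avg (fun i => fine (P (B `&` (Tpow Tm Tinv i @` C))))
  (mn N).1 (mn N).2.
have : EFin \o u @ \oo --> (fine (P B) * fine (Q C))%:E.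
  rewrite EFinM muleC [X in (_ * X)%E]fineK ?fin_num_measure//.
  suff -> : EFin \o u = fun N => (\int[P]_(w in B) (F N w)%:E)%E by exact: cvgF.
  by apply/funext => N; rewrite twosided_avg_integral.
move=> /fine_cvgP[_ /cvgrPdist_lt/(_ _ e0)[N _ /(_ N (leqnn N))]] /=.
by rewrite distrC ltNge; have [_ ->] := mnP N.
Qed.

(** With [B = C = A] invariant, every average is [P A], so [P A = P A * Q A]; as [P A = Q A], the
    number [Q A] is idempotent. *)
Lemma ergodic_of_mean_mixing :
  (forall B C : set Omega, measurable B -> measurable C ->
    lim_mn (twosided_avg (fun i => fine (P (B `&` (Tpow Tm Tinv i @` C)))))
           (fine (P B) * fine (Q C))) -> ergodic.
Proof.
move=> star A mA AT.
have imA i : Tpow Tm Tinv i @` A = A.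
  rewrite image_Tpow//; apply/seteqP.
  by split => x /=; rewrite (invariant_Tpow (Tinv := Tinv)).
have AA : fine (P A) = fine (P A) * fine (Q A).
  apply: lim_mn_twosided_avg_cst; have := star A A mA mA.
  by under eq_fun do rewrite imA setIid.
have QfE : Q A = (fine (Q A))%:E by rewrite fineK// fin_num_measure.
move: AA; rewrite PQ// => /eqP.
rewrite -{1}[fine (Q A)]mulr1 -subr_eq0 -mulrBr mulf_eq0.
move=> /orP[/eqP q0|]; first by left; rewrite QfE q0.
by rewrite subr_eq0 => /eqP q1; right; rewrite QfE -q1.
Qed.

(** The indicator of an invariant set is constant along orbits, so at any point off a [P]-null set
    its value, [0] or [1], is the limit [Q A]. Such a point exists because [P] has mass one. *)
Lemma ergodic_of_two_sided_birkhoff :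
  (forall f : Omega -> R, measurable_fun setT f ->
    Q.-integrable setT (EFin \o f) ->
    {ae P, forall w, lim_mn (twosided_avg (fun i => f (Tpow Tm Tinv i w)))
                            (fine (\int[Q]_x (f x)%:E))}) -> ergodic.
Proof.
move=> ss A mA AT.
have QfE : Q A = (fine (Q A))%:E by rewrite fineK// fin_num_measure.
have [N [mN PN0 NP]] := ss \1_A (measurable_indic mA) (integrable_indic Q mA).
have [w Nw] : exists w, ~ N w.
  apply: contrapT => /forallNP h.
  have NT : N = setT by apply/seteqP; split => // x _; apply: contrapT; exact: h.
  have := @probability_setT _ _ _ P; rewrite -NT PN0 => /eqP.
  by rewrite eqe eq_sym oner_eq0.
have := contra_not (@NP w) Nw => /contrapT /=.
rewrite (integral_indic Q measurableT mA) setIT => wP.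
have wA : \1_A w = fine (Q A).
  apply: lim_mn_twosided_avg_cst; move: wP.
  have E k : \1_A (Tpow Tm Tinv k w) = \1_A w :> R.
    rewrite !indicE; congr (_ (nat_of_bool _)).
    by apply/idP/idP; rewrite !inE (invariant_Tpow (Tinv := Tinv)).
  by under eq_fun do rewrite E.
by rewrite QfE -wA indicE; case: (_ \in _); [right|left].
Qed.

End ergodic_limit.

(** * Existence of the limit probability *)

Lemma pushforward_measure_exists {d : measure_display} {T : measurableType d}
  {R : realType} (P : {measure set T -> \bar R}) (f : T -> T) :
  measurable_fun setT f ->
  exists nu : {measure set T -> \bar R}, forall A, nu A = P (f @^-1` A).
Proof. by move=> mf; exists (pushforward P f). Unshelve. exact: mf. Qed.

Section average_limit.
Context {d : measure_display} {Omega : measurableType d} {R : realType}.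
Context {P : probability Omega R} {Tm Tinv : Omega -> Omega}.
Hypothesis mTm : measurable_fun setT Tm.
Hypothesis mTinv : measurable_fun setT Tinv.
Hypothesis TK : cancel Tm Tinv.
Hypothesis TinvK : cancel Tinv Tm.

(** All summands equal [P A], so the averages are constant from [n = 1] on. This serves both for the
    total mass of the limit and for its agreement with [P] on invariant sets. *)
Lemma avgP_invariant (A : set Omega) : Tm @^-1` A = A ->
  avgP P Tm Tinv A @ \oo --> fine (P A).
Proof.
move=> AT; apply: cvg_near_cst; exists 1%N => // n /= n0.
rewrite /avgP (eq_bigr (fun=> fine (P A))).
  rewrite sumr_const card_ord -(mulr_natl (fine _)) mulrA mulVf ?mul1r//.
  by rewrite pnatr_eq0 -lt0n.
move=> i _; congr (fine (P _)); rewrite (image_Tpow TK TinvK).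
by apply/seteqP; split => x /=; rewrite (invariant_Tpow (Tinv := Tinv)).
Qed.

(** The two sums are shifts of each other, so only one end term of each survives in the difference,
    and both lie between [0] and [1]. *)
Lemma avgP_preimage (A : set Omega) (n : nat) : measurable A ->
  `|avgP P Tm Tinv A n - avgP P Tm Tinv (Tm @^-1` A) n| <= n%:R^-1.
Proof.
move=> mA.
have p01 i B : measurable B -> 0 <= fine (P (Tpow Tm Tinv i @` B)) <= 1.
  move=> mB; have mTB := measurable_image_Tpow mTm mTinv TK TinvK i B mB.
  rewrite fine_ge0//= -lee_fin fineK ?fin_num_measure//.
  exact: probability_le1.
have mTA : measurable (Tm @^-1` A) by rewrite -[X in measurable X]setTI; exact: mTm.
rewrite /avgP; case: n => [|n]; first by rewrite invr0 !mul0r subrr normr0.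
rewrite -mulrBr normrM ger0_norm ?invr_ge0// ler_piMr ?invr_ge0//.
rewrite [X in X - _]big_ord_recr [X in _ - X]big_ord_recl/=.
have E (i : 'I_n) : iter (bump 0 i) Tm @` (Tm @^-1` A) = iter i Tm @` A.
  rewrite /bump/= add1n; apply/seteqP; split => [_ [x Ax <-]|_ [x Ax <-]].
    by exists (Tm x) => //; rewrite /= -iterSr.
  by exists (Tinv x); rewrite /= ?TinvK// -iterS iterSr TinvK.
under [X in _ - (_ + X)]eq_bigr do rewrite E.
have /andP[a0 a1] := p01 n A mA; have /andP[b0 b1] := p01 0 _ mTA.
move: a0 a1 b0 b1; rewrite /Tpow/=; set s := \sum_(i < n) _ => a0 a1 b0 b1.
by rewrite ler_norml; apply/andP; split; lra.
Qed.

Lemma avgP_limit_probability :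
  (forall A, measurable A -> cvgn (avgP P Tm Tinv A)) ->
  exists Q : probability Omega R,
    forall A, measurable A -> avgP P Tm Tinv A @ \oo --> fine (Q A).
Proof.
move=> hlim.
(* Taking images under powers of [Tm] is taking preimages under powers of [Tinv], so the averages
   are scaled sums of pushforwards of [P], hence measures. *)
have [p pE] := choice (fun i =>
  pushforward_measure_exists P (iter i Tinv) (measurable_fun_iter Tinv i mTinv)).
have n0 n : 0 <= n%:R^-1 :> R by rewrite invr_ge0.
pose mu n : {measure set Omega -> \bar R} := mscale (NngNum (n0 n)) (msum p n).
have muE n A : measurable A -> mu n A = (avgP P Tm Tinv A n)%:E.
  move=> mA; rewrite /mu/= /mscale/= /msum /avgP EFinM -sumEFin; congr (_ * _)%E.
  apply: eq_bigr => i _; rewrite pE fineK; last first.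
    by rewrite fin_num_measure//; exact: measurable_image_Tpow.
  rewrite (image_Tpow TK TinvK); congr (P _); by case: (nat_of_ord i).
have [||nu nuE] := @setwise_limit_measure _ _ _ mu.
- by move=> n A mA; rewrite muE.
- move=> A mA; rewrite (_ : (fun n => _) = avgP P Tm Tinv A); first exact: hlim.
  by apply/funext => n; rewrite muE.
have {}nuE A : measurable A -> nu A = (limn (avgP P Tm Tinv A))%:E.
  move=> mA; rewrite nuE//; congr (limn _)%:E.
  by apply/funext => n; rewrite muE.
have nu1 : nu setT = 1%E.
  rewrite nuE//; congr EFin; apply/cvg_lim => //.
  have := avgP_invariant setT (preimage_setT _); by rewrite probability_setT.
(* [P] is only the value of [mnormalize] when [nu setT] is [0] or [+oo]. *)
exists (mnormalize nu P) => A mA.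
rewrite /= /mnormalize nu1 onee_eq0/= invr1 mule1 nuE//; exact: hlim.
Qed.

End average_limit.

(** * Invariance of the limit and the equivalences *)

Theorem theorem4p7 (d : measure_display) (Omega : measurableType d) (R : realType)
  (P : probability Omega R) (Tm Tinv : Omega -> Omega)
  (mTm : measurable_fun setT Tm) (mTinv : measurable_fun setT Tinv)
  (TK : cancel Tm Tinv) (TinvK : cancel Tinv Tm)
  (hlim : forall A : set Omega, measurable A -> cvgn (avgP P Tm Tinv A)) :
  exists Q : probability Omega R,
    (forall A : set Omega, measurable A -> avgP P Tm Tinv A @ \oo --> fine (Q A))
    /\ (forall A : set Omega, measurable A -> Q (Tm @^-1` A) = Q A)
    /\ let ergodic := forall A : set Omega, measurable A -> Tm @^-1` A = A ->
                        Q A = 0%E \/ Q A = 1%E in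
       let star := forall B C : set Omega, measurable B -> measurable C ->
         lim_mn (twosided_avg (fun i => fine (P (B `&` (Tpow Tm Tinv i @` C)))))
                (fine (P B) * fine (Q C)) in
       let starstar := forall f : Omega -> R, measurable_fun setT f ->
         Q.-integrable setT (EFin \o f) ->
         {ae P, forall w, lim_mn (twosided_avg (fun i => f (Tpow Tm Tinv i w)))
                                 (fine (\int[Q]_x (f x)%:E))} in
       (ergodic -> star /\ starstar) /\ (star -> ergodic) /\ (starstar -> ergodic).
Proof.
have [Q cvgQ] := avgP_limit_probability mTm mTinv TK TinvK hlim.
have fin_eq (m1 m2 : probability Omega R) A B : measurable A -> measurable B ->
    fine (m1 A) = fine (m2 B) -> m1 A = m2 B.
  move=> mA mB AB; rewrite -[LHS]fineK ?fin_num_measure// AB fineK//.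
  by rewrite fin_num_measure.
have Q_inv A : measurable A -> Q (Tm @^-1` A) = Q A.
  move=> mA.
  have mTA : measurable (Tm @^-1` A) by rewrite -[X in measurable X]setTI; exact: mTm.
  apply: fin_eq => //; apply/esym/eqP; rewrite -subr_eq0; apply/eqP.
  (* The averages of [A] and of its preimage differ by at most [n%:R^-1], so the difference of their
     limits is also [0]. *)
  apply: (cvg_unique _ (cvgB (cvgQ _ mA) (cvgQ _ mTA))); first exact: norm_hausdorff.
  apply/cvgrPdist_lt => e e0; near=> n; rewrite sub0r normrN.
  apply: (le_lt_trans (avgP_preimage mTm mTinv TK TinvK A n mA)).
  near: n; apply: near_inftyS; exact: (near_infty_natSinv_lt (PosNum e0)).
have PQ A : measurable A -> Tm @^-1` A = A -> P A = Q A.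
  move=> mA AT; apply: fin_eq => //.
  exact: (cvg_unique _ (avgP_invariant TK TinvK A AT) (cvgQ _ mA)).
exists Q; split => //; split => // ergodic star starstar.
(* Proved first because mixing is deduced from pointwise convergence for the indicator of [C]. *)
have ss : ergodic -> starstar.
  by move=> erg f _; exact: ergodic_two_sided_birkhoff.
split; [|split].
- move=> erg; split; last exact: ss.
  move=> B C mB mC; apply: two_sided_mean_mixing => //.
  have := ss erg \1_C (measurable_indic mC) (integrable_indic Q mC).
  by rewrite (integral_indic Q measurableT mC) setIT.
- exact: ergodic_of_mean_mixing.
- exact: ergodic_of_two_sided_birkhoff.
Unshelve. all: by end_near.
Qed.
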